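(* Fix positive integers $n$ and $b$ with $b \mid n$, and fix $n\times n$ permutation matrices $P_L, P, P_R$. Let $\mathcal{GS}(P_L,P,P_R)$ denote the set of all $n\times n$ orthogonal matrices $A$ that can be written as $A = P_L\, L\, P\, R\, P_R$, where $L=\operatorname{diag}(L_1,\dots,L_{n/b})$ and $R=\operatorname{diag}(R_1,\dots,R_{n/b})$ are block-diagonal matrices with blocks $L_i,R_i\in\mathbb{R}^{b\times b}$. Then $\mathcal{GS}(P_L,P,P_R)$ is a smooth (embedded) submanifold of the orthogonal group $\mathrm{O}(n)$ (and of $\mathrm{GL}_n(\mathbb{R})$).
   Context: An $n\times n$ real matrix $A$ is orthogonal if $A^\top A=I$. It is a known fact (used freely) that every orthogonal matrix in $\mathcal{GS}(P_L,P,P_R)$ admits such a representation in which all diagonal blocks $L_i, R_i$ are themselves orthogonal, so $\mathcal{GS}(P_L,P,P_R)=\{P_L L P R P_R : L,R \text{ block-diagonal with } n/b \text{ orthogonal } b\times b \text{ blocks}\}$. *)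

(* Defs.v *)
From HB Require Import structures.
From mathcomp Require Import all_boot all_order all_algebra all_fingroup.
From mathcomp Require Import all_classical all_reals all_analysis.
Set Implicit Arguments. Unset Strict Implicit. Unset Printing Implicit Defensive.
Import Order.TTheory GRing.Theory Num.Theory.
Import numFieldNormedType.Exports.
Local Open Scope classical_set_scope.
Local Open Scope ring_scope.

Fixpoint iter_derive (R : realType) (V W : normedModType R)
    (vs : seq V) (f : V -> W) : V -> W :=
  match vs with
  | [::] => f
  | v :: vs' => fun x => 'D_v (iter_derive vs' f) x
  end.

(* f is C^infinity on the open set U (finite-dimensional V, W): every iterated
   directional derivative exists on U and is continuous on U. *)
Definition smooth_on (R : realType) (V W : normedModType R)
    (U : set V) (f : V -> W) : Prop :=
  forall (vs : seq V),
    (forall v x, U x -> derivable (iter_derive vs f) x v) /\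
    {within U, continuous (iter_derive vs f)}.

(* S is a smooth embedded submanifold of the finite-dimensional space V:
   locally S is a regular level set of a smooth submersion. *)
Definition embedded_submanifold (R : realType) (V : normedModType R)
    (S : set V) : Prop :=
  forall p, S p ->
    exists (U : set V) (k : nat) (F : V -> 'rV[R]_k),
      [/\ open U, U p, smooth_on U F,
          (forall x, U x -> (S x <-> F x = 0)) &
          (forall x, U x -> S x -> forall w : 'rV[R]_k,
              exists v : V, 'D_v F x = w)].

Definition orthogonal_mx (R : realType) (n : nat) : set 'M[R]_n :=
  [set A | A^T *m A = 1%:M].

Definition block_diag_b (R : realType) (n b : nat) (M : 'M[R]_n) : Prop :=
  forall i j : 'I_n, (i %/ b)%N != (j %/ b)%N -> M i j = 0.

Definition GS (R : realType) (n b : nat) (PL P PR : 'S_n) : set 'M[R]_n :=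
  [set A | A^T *m A = 1%:M /\
     exists L Rm : 'M[R]_n, [/\ block_diag_b b L, block_diag_b b Rm &
        A = perm_mx PL *m L *m perm_mx P *m Rm *m perm_mx PR]].

(* Main.v *)
(* Permutations translate GS into the set of orthogonal products C = L K, with L
   block-diagonal for one partition c1 of the indices and K for another one c2.
   The factors can be taken orthogonal: L^T L = (K K^T)^-1 lies in both block
   algebras, and so does a Cholesky factor of it.  Hence it suffices to describe
   the set near the identity.  Let E_j be the coordinate projection onto the
   c2-class of j.  An orthogonal C close to 1 is such a product iff every
   projection Q_j = C E_j C^T is block-diagonal for c1: then L = C D^T and
   K = (D^T)^-1 work, D being the c2-diagonal part of C.  These equations are
   redundant, but (C^T C)_xy = 1_xy for x <= y together with (Q_y)_xy = 0 for
   x > y in different c1- and c2-classes imply all of them near 1, and they are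
   independent at 1.  The equations are polynomial, so smoothness is automatic. *)
Require Import Defs.
From HB Require Import structures.
From mathcomp Require Import all_boot all_order all_algebra all_fingroup.
From mathcomp Require Import all_classical all_reals all_analysis.
From mathcomp Require Import ring.
Set Implicit Arguments. Unset Strict Implicit. Unset Printing Implicit Defensive.
Import Order.TTheory GRing.Theory Num.Theory.
Import numFieldNormedType.Exports.
Local Open Scope classical_set_scope.
Local Open Scope ring_scope.

(** * Polynomial maps on matrix spaces: smoothness, submersions and local charts *)

Section PolynomialMaps.
Context {R : realType} {m n : nat}.
Local Notation V := 'M[R]_(m, n).

(** An inductive predicate on functions, so that continuity and a polynomial gradient both follow by
    induction on the way the function is built. *)
Inductive polyfun : (V -> R) -> Prop :=
| polyfun_cst c : polyfun (fun=> c)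
| polyfun_coord i j : polyfun (fun A => A i j)
| polyfunD f g : polyfun f -> polyfun g -> polyfun (fun A => f A + g A)
| polyfunM f g : polyfun f -> polyfun g -> polyfun (fun A => f A * g A).

Lemma polyfun_sum (I : Type) (r : seq I) (P : pred I) (f : I -> V -> R) :
  (forall i, polyfun (f i)) -> polyfun (fun A => \sum_(i <- r | P i) f i A).
Proof.
move=> fP; elim: r => [|i r IHr].
  rewrite (_ : (fun A => _) = fun=> 0); first exact: polyfun_cst.
  by apply/funext => A; rewrite big_nil.
rewrite (_ : (fun A => _) = fun A =>
    (if P i then f i A else 0) + \sum_(j <- r | P j) f j A).
  by apply: polyfunD => //; case: (P i) => //; exact: polyfun_cst.
by apply/funext => A; rewrite big_cons; case: (P i); rewrite ?add0r.
Qed.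

Lemma polyfun_prod (I : Type) (r : seq I) (P : pred I) (f : I -> V -> R) :
  (forall i, polyfun (f i)) -> polyfun (fun A => \prod_(i <- r | P i) f i A).
Proof.
move=> fP; elim: r => [|i r IHr].
  rewrite (_ : (fun A => _) = fun=> 1); first exact: polyfun_cst.
  by apply/funext => A; rewrite big_nil.
rewrite (_ : (fun A => _) = fun A =>
    (if P i then f i A else 1) * \prod_(j <- r | P j) f j A).
  by apply: polyfunM => //; case: (P i) => //; exact: polyfun_cst.
by apply/funext => A; rewrite big_cons; case: (P i); rewrite ?mul1r.
Qed.

Lemma polyfun_det k (M : V -> 'M[R]_k) :
  (forall i j, polyfun (fun A => M A i j)) -> polyfun (fun A => \det (M A)).
Proof.
move=> MP; apply: polyfun_sum => s; apply: polyfunM; first exact: polyfun_cst.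
exact: polyfun_prod.
Qed.

Lemma polyfun_mulmx k l q (M : V -> 'M[R]_(k, l)) (N : V -> 'M[R]_(l, q)) :
  (forall i j, polyfun (fun A => M A i j)) ->
  (forall i j, polyfun (fun A => N A i j)) ->
  forall i j, polyfun (fun A => (M A *m N A) i j).
Proof.
move=> MP NP i j.
rewrite (_ : (fun A => _) = fun A => \sum_l M A i l * N A l j).
  by apply: polyfun_sum => h; exact: polyfunM.
by apply/funext => A; rewrite mxE.
Qed.

Lemma polyfun_continuous f : polyfun f -> continuous f.
Proof.
elim=> [c|i j|{}f g _ fc _ gc|{}f g _ fc _ gc] x.
- exact: cst_continuous.
- exact: coord_continuous.
- by apply: continuousD; [exact: fc|exact: gc].
- by apply: continuousM; [exact: fc|exact: gc].
Qed.

(** The gradient [g] is exposed as polynomials in the base point: for a fixed direction the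
    derivative is then again polynomial, so the result can be iterated. *)
Lemma polyfun_derive f : polyfun f ->
  exists2 g : 'I_m -> 'I_n -> V -> R, (forall i j, polyfun (g i j)) &
    forall A v : V, is_derive A v f (\sum_i \sum_j v i j * g i j A).
Proof.
elim=> [c|i j|{}f g _ [f' f'P df] _ [g' g'P dg]|
        {}f g fP [f' f'P df] gP [g' g'P dg]].
- exists (fun _ _ => fun=> 0) => [i j|A v]; first exact: polyfun_cst.
  rewrite big1; first exact: is_derive_cst.
  by move=> i _; rewrite big1 // => j _; rewrite mulr0.
- exists (fun i' j' => fun=> ((i' == i) && (j' == j))%:R) => [? ?|A v].
    exact: polyfun_cst.
  rewrite (bigD1 i) //= [X in _ + X]big1 ?addr0; last first.
    by move=> i' /negPf ne; rewrite big1 // => j' _; rewrite ne mulr0.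
  rewrite (bigD1 j) //= big1 ?addr0; last first.
    by move=> j' /negPf ne; rewrite ne andbF mulr0.
  rewrite !eqxx mulr1.
  have [dm em] : derivable (fun B : V => B i j) A v /\
      'D_v (fun B : V => B i j) A = v i j.
    have idP : derivable (@id V) A v by [].
    split; first exact: (derivable_mxP (@id V) A v).1.
    have := derive_mx idP; rewrite derive_id => /matrixP/(_ i j).
    by rewrite mxE.
  exact: DeriveDef.
- exists (fun i j A => f' i j A + g' i j A) => [i j|A v]; first exact: polyfunD.
  apply: is_derive_eq.
  rewrite -big_split; apply: eq_bigr => i _; rewrite -big_split.
  by apply: eq_bigr => j _; rewrite mulrDr.
- exists (fun i j A => f A * g' i j A + g A * f' i j A) => [i j|A v].
    by apply: polyfunD; exact: polyfunM.
  apply: (@is_derive_eq _ _ _ (f * g)).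
  rewrite !scaler_sumr -big_split; apply: eq_bigr => i _.
  rewrite !scaler_sumr -big_split; apply: eq_bigr => j _.
  by rewrite mulrDr /GRing.scale /= !mulrA ![v i j * _]mulrC.
Qed.

Lemma polyfun_cvg_mx k l (F : V -> 'M[R]_(k, l)) :
  (forall i j, polyfun (fun A => F A i j)) -> continuous F.
Proof.
move=> FP A; apply/(cvg_ballP (FF := nbhs_filter A)) => e e0.
suff : \forall B \near A, forall i j, ball (F A i j) e (F B i j).
  by apply: filterS => B; split.
apply: (filter_forall (nbhs_filter A)) => i.
apply: (filter_forall (nbhs_filter A)) => j.
have Fc : continuous (fun B => F B i j) by exact: polyfun_continuous.
by have /(cvg_ballP (FF := nbhs_filter A)) := Fc A; apply.
Qed.

Lemma polyfun_derive_mx k l (F : V -> 'M[R]_(k, l)) :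
  (forall i j, polyfun (fun A => F A i j)) ->
  exists g : 'I_k -> 'I_l -> 'I_m -> 'I_n -> V -> R,
  [/\ forall i j i' j', polyfun (g i j i' j'),
    forall A v, derivable F A v &
    forall A v, 'D_v F A = \matrix_(i, j) \sum_i' \sum_j' v i' j' * g i j i' j' A].
Proof.
move=> FP; pose P i j := fun g : 'I_m -> 'I_n -> V -> R =>
  (forall i' j', polyfun (g i' j')) /\
  forall A v : V, is_derive A v (fun A => F A i j)
    (\sum_i' \sum_j' v i' j' * g i' j' A).
have ex_g i j : exists g, P i j g.
  by have [g gP dg] := polyfun_derive (FP i j); exists g.
pose g i j := projT1 (cid (ex_g i j)).
have gP i j : P i j (g i j) := projT2 (cid (ex_g i j)).
have dF A v : derivable F A v.
  by apply/derivable_mxP => i j; have [_ /(_ A v)[]] := gP i j.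
exists g; split=> // [i j i' j'|A v]; first by have [] := gP i j.
rewrite derive_mx //; apply/matrixP => i j; rewrite !mxE.
by have [_ /(_ A v)[]] := gP i j.
Qed.

Lemma polyfun_smooth k (F : V -> 'rV[R]_k) (U : set V) :
  (forall i j, polyfun (fun A => F A i j)) -> smooth_on U F.
Proof.
move=> FP vs.
have itP : forall i j, polyfun (fun A => iter_derive vs F A i j).
  elim: vs => //= v vs IHvs i j.
  have [g [gP _ dg]] := polyfun_derive_mx IHvs.
  under eq_fun do rewrite dg mxE.
  by do 2!apply: polyfun_sum => ?; apply: polyfunM; [exact: polyfun_cst|].
split=> [v A _|].
  by have [g [_ + _]] := polyfun_derive_mx itP; apply.
by apply: continuous_subspaceT; exact: polyfun_cvg_mx.
Qed.

(** Surjectivity of the differential is an open condition: along preimages [T i] of the basis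
    vectors the Jacobian is 1 at [p], and its determinant, a polynomial, stays nonzero nearby. *)
Lemma polyfun_submersion_near k (F : V -> 'rV[R]_k) (p : V) :
  (forall i j, polyfun (fun A => F A i j)) ->
  (forall w, exists v, 'D_v F p = w) ->
  \forall A \near p, forall w, exists v, 'D_v F A = w.
Proof.
move=> FP sF; have [g [gP _ dg]] := polyfun_derive_mx FP.
pose T i := projT1 (cid (sF (delta_mx 0 i))).
have TP i : 'D_(T i) F p = delta_mx 0 i := projT2 (cid (sF (delta_mx 0 i))).
pose J A : 'M[R]_k := \matrix_(i < k, j < k) 'D_(T i) F A 0 j.
have detP : polyfun (fun A => \det (J A)).
  apply: polyfun_det => i j; under eq_fun do rewrite mxE dg mxE.
  by do 2!apply: polyfun_sum => ?; apply: polyfunM; [exact: polyfun_cst|].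
have J1 : J p = 1%:M.
  by apply/matrixP => i j; rewrite !mxE TP mxE eqxx eq_sym.
have : \forall A \near p, \det (J A) != 0.
  have detC : continuous (fun A => \det (J A)) by exact: polyfun_continuous.
  apply: (detC p [set x | x != 0]).
  apply: open_nbhs_nbhs; split; first exact: open_neq.
  by rewrite /= J1 det1 oner_neq0.
apply: filterS => A dA w.
have JU : J A \in unitmx by rewrite unitmxE unitfE.
pose c : 'rV[R]_k := w *m invmx (J A).
exists (\sum_i c 0 i *: T i).
have JE i j : J A i j = \sum_i' \sum_j' T i i' j' * g 0 j i' j' A.
  by rewrite mxE dg mxE.
rewrite -[w](mulmxKV JU) -/c; apply/matrixP => i0 j; rewrite (ord1 i0).
rewrite dg mxE [RHS]mxE.
transitivity (\sum_i' \sum_j' \sum_i c 0 i * (T i i' j' * g 0 j i' j' A)).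
  apply: eq_bigr => i' _; apply: eq_bigr => j' _.
  by rewrite summxE mulr_suml; apply: eq_bigr => i _; rewrite mxE mulrA.
under eq_bigr do rewrite exchange_big.
rewrite exchange_big; apply: eq_bigr => i _ /=.
by rewrite JE mulr_sumr; apply: eq_bigr => i' _; rewrite mulr_sumr.
Qed.

(** Submersivity is asked at [p] only; [polyfun_submersion_near] spreads it to a neighbourhood. *)
Definition poly_chart (S : set V) (p : V) : Prop :=
  exists k (F : V -> 'rV[R]_k),
  [/\ forall i j, polyfun (fun A => F A i j),
      \forall A \near p, S A <-> F A = 0 &
      forall w, exists v, 'D_v F p = w].

Lemma poly_chart_embedded (S : set V) :
  (forall p, S p -> poly_chart S p) -> embedded_submanifold S.
Proof.
move=> chart p Sp; have [k [F [FP SF sF]]] := chart p Sp.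
have : nbhs p ([set A | S A <-> F A = 0] `&`
    [set A | forall w, exists v, 'D_v F A = w]).
  by apply: filterI => //; exact: polyfun_submersion_near.
rewrite nbhsE => -[U [Uo Up] UP]; exists U, k, F; split=> //.
- exact: polyfun_smooth.
- by move=> A /UP[].
- by move=> A /UP[].
Qed.

End PolynomialMaps.

Lemma polyfun_comp (R : realType) m n k l (f : 'M[R]_(m, n) -> R)
    (t : 'M[R]_(k, l) -> 'M[R]_(m, n)) :
  polyfun f -> (forall i j, polyfun (fun A => t A i j)) ->
  polyfun (fun A => f (t A)).
Proof.
move=> fP tP; elim: fP => [c|i j|{}f g _ fP _ gP|{}f g _ fP _ gP].
- exact: polyfun_cst.
- exact: tP.
- exact: polyfunD.
- exact: polyfunM.
Qed.

(** The linear map sending A to U A W is onto, with right inverse sending v to U' v W', so composing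
    with it preserves polynomial submersions. *)
Lemma poly_chart_mulmx (R : realType) m n k l (S : set 'M[R]_(m, n))
    (U : 'M[R]_(m, k)) (U' : 'M[R]_(k, m)) (W : 'M[R]_(l, n)) (W' : 'M[R]_(n, l))
    (p : 'M[R]_(k, l)) :
  U *m U' = 1%:M -> W' *m W = 1%:M -> poly_chart S (U *m p *m W) ->
  poly_chart [set A | S (U *m A *m W)] p.
Proof.
move=> UU WW [q [F [FP SF sF]]]; pose t A := U *m A *m W.
have tP i j : polyfun (fun A => t A i j).
  apply: polyfun_mulmx => [? ?|? ?]; last exact: polyfun_cst.
  by apply: polyfun_mulmx => ? ?; [exact: polyfun_cst|exact: polyfun_coord].
exists q, (F \o t); split=> [i j||w].
- exact: (polyfun_comp (FP i j)).
- have tc : continuous t by exact: polyfun_cvg_mx.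
  exact: (tc p _ SF).
have [v <-] := sF w; exists (U' *m v *m W'); rewrite /derive.
(* By linearity of [t] the two difference quotients are equal for every h, which replaces the chain
   rule. *)
suff e : (fun h : R => h^-1 *: (((F \o t) \o shift p)
      (h *: (U' *m v *m W')) - (F \o t) p))
    = (fun h : R => h^-1 *: ((F \o shift (t p)) (h *: v) - F (t p))) by rewrite e.
apply/funext => h /=; rewrite /t mulmxDr mulmxDl.
by rewrite -scalemxAr -scalemxAl !mulmxA UU mul1mx -[v *m _ *m _]mulmxA WW mulmx1.
Qed.

Lemma is_derive_quadratic (R : realType) (V W : normedModType R) (F : V -> W)
    (A v : V) (b c : W) :
  (forall h : R, F (h *: v + A) = F A + h *: b + h ^+ 2 *: c) ->
  is_derive A v F b.
Proof.
move=> FE.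
have lim_b : h^-1 *: ((F \o shift A) (h *: v) - F A) @[h --> (0 : R)^'] --> b.
  have : b + h *: c @[h --> (0 : R)^'] --> b + 0 *: c.
    apply: cvgD; first exact: cvg_cst.
    apply: cvgZr_tmp; apply: cvg_within_filter; exact: cvg_id.
  rewrite scale0r addr0; apply: cvg_trans; apply: near_eq_cvg.
  near=> h; have h0 : h != 0 by near: h; exact: nbhs_dnbhs_neq.
  rewrite /= FE -[F A + _ + _]addrA [F A + _]addrC addrK scalerDr.
  by rewrite !scalerA mulVf // expr2 mulKf // scale1r.
by apply: DeriveDef; [apply/cvg_ex; exists b|exact: cvg_lim].
Unshelve. all: by end_near. Qed.

(** * Block algebras of index partitions, and Cholesky factors inside them *)

Section ClassBlocks.
Context {R : fieldType} {n : nat}.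
Implicit Types M N : 'M[R]_n.

(** A partition is a labelling with values in any [eqType]: [block_diag_b b] is the labelling by
    [i %/ b], and a common refinement is a labelling by pairs. *)
Definition class_block (T : eqType) (c : 'I_n -> T) M :=
  forall i j, c i != c j -> M i j = 0.

Definition class_proj (T : eqType) (c : 'I_n -> T) (a : T) : 'M[R]_n :=
  \matrix_(i, j) ((i == j) && (c j == a))%:R.

Context {T : eqType}.
Implicit Types c : 'I_n -> T.

Lemma mul_class_proj c a M i j :
  (class_proj c a *m M) i j = (c i == a)%:R * M i j.
Proof.
rewrite mxE (bigD1 i) //= big1 ?addr0 => [|k /negPf ki]; first by rewrite mxE eqxx.
by rewrite mxE eq_sym ki mul0r.
Qed.

Lemma mulmx_class_proj c a M i j :
  (M *m class_proj c a) i j = M i j * (c j == a)%:R.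
Proof.
rewrite mxE (bigD1 j) //= big1 ?addr0 => [|k /negPf kj]; first by rewrite mxE eqxx.
by rewrite mxE kj mulr0.
Qed.

(** The block algebra is the commutant of the coordinate projections; this makes its closure under
    products and inverses purely algebraic. *)
Lemma class_blockP c M :
  class_block c M <-> forall a, class_proj c a *m M = M *m class_proj c a.
Proof.
split=> [MB a|MC i j /negPf cij].
  apply/matrixP => i j; rewrite mul_class_proj mulmx_class_proj.
  have [->|/MB ->] := eqVneq (c i) (c j); first by rewrite mulrC.
  by rewrite mulr0 mul0r.
have /matrixP/(_ i j) := MC (c i).
by rewrite mul_class_proj mulmx_class_proj eqxx mul1r eq_sym cij mulr0.
Qed.

Lemma class_block1 c : class_block c 1%:M.
Proof. by move=> i j; rewrite mxE; have [->|//] := eqVneq i j; rewrite eqxx. Qed.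

Lemma class_blockM c M N :
  class_block c M -> class_block c N -> class_block c (M *m N).
Proof.
move=> /class_blockP MB /class_blockP NB; apply/class_blockP => a.
by rewrite mulmxA MB -mulmxA NB mulmxA.
Qed.

Lemma class_block_tr c M : class_block c M -> class_block c M^T.
Proof. by move=> MB i j; rewrite mxE eq_sym => /MB. Qed.

Lemma class_blockV c M : class_block c M -> class_block c (invmx M).
Proof.
(* For a singular M, [invmx M] is M itself by default. *)
move=> /class_blockP MB; have [MU|/invmx_out ->] := boolP (M \in unitmx); last first.
  exact/class_blockP.
apply/class_blockP => a.
apply: (can_inj (mulKmx MU)); apply: (can_inj (mulmxK MU)).
by rewrite !mulmxA -MB -!mulmxA mulVmx // mulmx1 mulKVmx.
Qed.

Lemma class_block_proj c (T' : eqType) (c' : 'I_n -> T') a :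
  class_block c (class_proj c' a).
Proof.
by move=> i j; rewrite mxE; have [->|] := eqVneq i j; rewrite ?eqxx.
Qed.

Lemma class_projM c a b :
  class_proj c a *m class_proj c b = if a == b then class_proj c a else 0.
Proof.
apply/matrixP => i j; rewrite mul_class_proj !mxE.
have [<-|/negPf ab] := eqVneq a b; rewrite mxE.
  have [->|_] /= := eqVneq i j; last by rewrite mulr0.
  by case: (c j == a); rewrite ?mulr1 ?mulr0.
have [->|_] /= := eqVneq i j; last by rewrite mulr0.
by have [->|_] := eqVneq (c j) a; rewrite ?ab ?mulr0 ?mul0r.
Qed.

End ClassBlocks.

(** Induction on the size: clear the first row and column, then recurse on the Schur complement. The
    elimination only uses entries of the first row, which vanish outside the class of index 0, so
    every matrix involved keeps the block pattern. *)
Lemma class_block_cholesky (R : rcfType) (T : eqType) n (c : 'I_n -> T)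
    (H : 'M[R]_n) :
  H^T = H -> (forall v : 'cV[R]_n, v != 0 -> 0 < (v^T *m H *m v) 0 0) ->
  class_block c H ->
  exists D, [/\ D \in unitmx, class_block c D & D^T *m H *m D = 1%:M].
Proof.
elim: n => [|n IHn] in c H *.
  move=> _ _ _; exists 1%:M; rewrite unitmx1; split=> //.
    exact: class_block1.
  by apply/matrixP => -[].
move=> Hs Hp HB.
pose h := H 0 0.
have h0 : 0 < h.
  have := Hp (delta_mx 0 0).
  rewrite trmx_delta -rowE -colE !mxE; apply.
  apply/eqP => /matrixP/(_ 0 0); rewrite !mxE !eqxx => /eqP.
  by rewrite oner_eq0.
pose H4 : 'M[R]_(1 + n) := H.
pose r : 'rV[R]_n := ursubmx H4.
have rE j : r 0 j = H 0 (lift ord0 j).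
  rewrite !mxE; congr (H _ _); apply: val_inj => //.
have dE i j : drsubmx H4 i j = H (lift ord0 i) (lift ord0 j).
  by rewrite !mxE; congr (H _ _); apply: val_inj.
have H4E : H4 = block_mx h%:M r r^T (drsubmx H4).
  rewrite -[LHS]submxK; congr block_mx.
    apply/matrixP => i j; rewrite !ord1 !mxE eqxx /h.
    by congr (H _ _); apply: val_inj.
  by rewrite -[LHS]trmxK trmx_dlsub [H4^T]Hs.
(* X is the elimination matrix and S the Schur complement of h. *)
pose X : 'M[R]_(1 + n) := block_mx 1%:M (- h^-1 *: r) 0 1%:M.
pose S := drsubmx H4 - h^-1 *: (r^T *m r).
have XH : X^T *m H4 *m X = block_mx h%:M 0 0 S.
  rewrite H4E tr_block_mx !mulmx_block !trmx1 !trmx0 !mul1mx !mul0mx !addr0.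
  rewrite !mulmx0 !mulmx1 !addr0 !linearZ /= mul_scalar_mx -!scalemxAl.
  rewrite mul_mx_scalar !scalerA mulNr mulVf ?gt_eqF // !scaleN1r !addNr.
  by rewrite mul0mx scaler0 add0r scaleNr addrC.
have XU : X \in unitmx by rewrite unitmxE det_ublock !det1 mulr1 unitr1.
have lift0 : lshift n (0 : 'I_1) = 0 :> 'I_(1 + n) by apply: val_inj.
have lift1 j : rshift 1 j = lift ord0 j :> 'I_(1 + n) by apply: val_inj.
have XB : @class_block R (1 + n) T c X.
  move=> i j; rewrite -[i](splitK (m := 1)) -[j](splitK (m := 1)).
  case: (fintype.split _) => i'; case: (fintype.split _) => j' /=;
    rewrite ?(ord1 i') ?(ord1 j') => cij.
  - by rewrite eqxx in cij.
  - rewrite /X block_mxEur mxE rE -lift1 HB ?mulr0 //.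
    by rewrite lift0 in cij.
  - by rewrite /X block_mxEdl mxE.
  - by rewrite /X block_mxEdr mxE; have [e|//] := eqVneq i' j'; rewrite e eqxx in cij.
pose c' i := c (lift ord0 i).
have [] := IHn c' S.
- rewrite /S linearB linearZ /= trmx_mul trmxK; congr (_ - _).
  by apply/matrixP => i j; rewrite mxE !dE -[in LHS]Hs mxE.
- move=> v v0; pose u : 'cV[R]_(1 + n) := X *m col_mx 0 v.
  have u0 : u != 0.
    apply: contraNneq v0 => /(congr1 (mulmx (invmx X))).
    by rewrite mulKmx // mulmx0 -col_mx0 => /eq_col_mx[_ ->].
  have := Hp u u0; rewrite -/H4 /u trmx_mul !mulmxA -[_ *m X^T *m H4]mulmxA.
  rewrite -[_ *m (X^T *m H4) *m X]mulmxA XH.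
  rewrite tr_col_mx trmx0 mul_row_block mul_row_col !mul0mx !mulmx0.
  by rewrite !add0r.
- move=> i j cij; have -> : S i j = H (lift ord0 i) (lift ord0 j) -
      h^-1 * (H 0 (lift ord0 i) * H 0 (lift ord0 j)).
    rewrite /S mxE dE mxE [X in _ - X]mxE; congr (_ - _ * _).
    by rewrite mxE big_ord1 mxE !rE.
  (* Index 0 cannot share a class with both i and j, so one factor of the correction term is
     zero. *)
  rewrite (HB _ _ cij) sub0r.
  have [c0j|c0j] := eqVneq (c 0) (c (lift ord0 j)).
    by rewrite [H 0 (lift ord0 i)]HB ?mul0r ?mulr0 ?oppr0 // c0j eq_sym.
  by rewrite [H 0 (lift ord0 j)]HB ?mulr0 ?oppr0.
move=> D0 [D0U D0B D0E].
pose Y : 'M[R]_(1 + n) := block_mx (Num.sqrt h)^-1%:M 0 0 D0.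
have sh0 : Num.sqrt h != 0 by rewrite gt_eqF // sqrtr_gt0.
have YU : Y \in unitmx.
  rewrite unitmxE /Y det_ublock det_scalar expr1 unitrM -unitmxE D0U.
  by rewrite unitrV unitfE sh0.
have YB : @class_block R (1 + n) T c Y.
  move=> i j; rewrite -[i](splitK (m := 1)) -[j](splitK (m := 1)).
  case: (fintype.split _) => i'; case: (fintype.split _) => j' /=;
    rewrite ?(ord1 i') ?(ord1 j') => cij.
  - by rewrite eqxx in cij.
  - by rewrite /Y block_mxEur mxE.
  - by rewrite /Y block_mxEdl mxE.
  - by rewrite /Y block_mxEdr D0B // /c' -!lift1.
exists (X *m Y); split.
- by rewrite unitmx_mul XU.
- exact: class_blockM XB YB.
- have YH : Y^T *m block_mx h%:M 0 0 S *m Y = 1%:M.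
    rewrite tr_block_mx !mulmx_block !trmx0 !mulmx0 !mul0mx !addr0 !add0r D0E.
    rewrite tr_scalar_mx -!scalar_mxM mulrAC -invfM -expr2 sqr_sqrtr ?ltW //.
    rewrite mulVf ?gt_eqF // !mul0mx.
    exact/esym/scalar_mx_block.
  by rewrite -YH -XH trmx_mul !mulmxA.
Qed.

(** * Orthogonal products of two block matrices and their conjugated projections *)

Section OrthogonalProducts.
Context {R : rcfType} {T1 T2 : eqType} {n : nat}.
Variables (c1 : 'I_n -> T1) (c2 : 'I_n -> T2).
Implicit Types A C L K : 'M[R]_n.

Definition orth_product C := C^T *m C = 1%:M /\
  exists L K, [/\ class_block c1 L, class_block c2 K & C = L *m K].

(** With D the inverse of a Cholesky factor of L^T L, the new factors are L D and D^-1 K; D lies in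
    both block algebras, so each factor stays in its own. *)
Lemma orth_product_factors C : orth_product C ->
  exists L K, [/\ class_block c1 L, class_block c2 K, C = L *m K,
    L^T *m L = 1%:M & K^T *m K = 1%:M].
Proof.
move=> [C1 [L [K [LB KB CE]]]].
have : L *m K \in unitmx by rewrite -CE; case/mulmx1_unit: C1.
rewrite unitmx_mul => /andP[LU KU].
have HE : L^T *m L = invmx K^T *m invmx K.
  apply: (can_inj (mulmxK KU)); rewrite mulmxKV //.
  apply: (can_inj (mulKmx (_ : K^T \in unitmx))); rewrite ?unitmx_tr //.
  by rewrite mulmxV ?unitmx_tr // -C1 CE trmx_mul !mulmxA.
(* The classes of c are the intersections of c1- and c2-classes, so its block algebra is the
   intersection of the two. *)
pose c i := (c1 i, c2 i).
have HB : class_block c (L^T *m L).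
  move=> i j; rewrite xpair_eqE negb_and => /orP[c1ij|c2ij].
    by apply: (class_blockM (class_block_tr LB) LB).
  rewrite HE; apply: class_blockM c2ij; last exact: class_blockV.
  exact/class_blockV/class_block_tr.
have [||D [DU DB DE]] := class_block_cholesky _ _ HB.
- by rewrite trmx_mul trmxK.
- move=> v v0; rewrite mulmxA -trmx_mul -mulmxA mxE.
  have [i Lvi] : exists i, (L *m v) i 0 != 0.
    apply/existsP; apply: contraNT v0; rewrite negb_exists => /forallP Lv.
    apply/eqP; apply: (can_inj (mulKmx LU)); rewrite mulmx0.
    by apply/matrixP => i j; rewrite (ord1 j) [RHS]mxE; apply/eqP;
      rewrite -[_ == _]negbK.
  rewrite (bigD1 i) //= ltr_pwDl //.
    by rewrite [X in X * _]mxE -expr2 exprn_even_gt0.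
  by apply: sumr_ge0 => k _; rewrite [X in X * _]mxE -expr2 sqr_ge0.
have DB1 : class_block c1 D.
  by move=> i j cij; apply: DB; rewrite xpair_eqE negb_and cij.
have DB2 : class_block c2 D.
  by move=> i j cij; apply: DB; rewrite xpair_eqE negb_and cij orbT.
have LD : (L *m D)^T *m (L *m D) = 1%:M by rewrite -DE trmx_mul !mulmxA.
have CE' : C = (L *m D) *m (invmx D *m K) by rewrite -mulmxA mulKVmx.
exists (L *m D), (invmx D *m K); split=> //.
- exact: class_blockM.
- exact/class_blockM/KB/class_blockV.
- have -> : invmx D *m K = (L *m D)^T *m C by rewrite CE' mulmxA LD mul1mx.
  by rewrite trmx_mul trmxK mulmxA -[_ *m (_ *m _) *m _]mulmxA (mulmx1C LD) mulmx1.
Qed.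

(** For orthogonal C this is the orthogonal projection onto the span of the columns in the class of
    j. Indexing by j rather than by its label keeps the family finite and lets [conj_proj C y] be
    attached to the entry (x, y). *)
Definition conj_proj C (j : 'I_n) := C *m class_proj c2 (c2 j) *m C^T.

Lemma conj_projE C j x y :
  conj_proj C j x y = \sum_(z | c2 z == c2 j) C x z * C y z.
Proof.
rewrite mxE [RHS]big_mkcond; apply: eq_bigr => z _.
by rewrite mulmx_class_proj mxE; case: (c2 z == _); rewrite ?mulr1 ?mulr0 ?mul0r.
Qed.

Lemma conj_proj_sym C j x y : conj_proj C j x y = conj_proj C j y x.
Proof. by rewrite !conj_projE; apply: eq_bigr => z _; rewrite mulrC. Qed.

Lemma conj_projM C j k : C^T *m C = 1%:M -> conj_proj C j *m conj_proj C k =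
  if c2 j == c2 k then conj_proj C j else 0.
Proof.
move=> C1; rewrite /conj_proj !mulmxA -[_ *m C^T *m C]mulmxA C1 mulmx1.
rewrite -[X in X *m _]mulmxA class_projM; case: eqP => // _.
by rewrite mulmx0 mul0mx.
Qed.

(** With orthogonal factors, K commutes with E_j and cancels against its transpose, leaving L E_j
    L^T. *)
Lemma orth_product_conj_proj C j : orth_product C -> class_block c1 (conj_proj C j).
Proof.
move=> /orth_product_factors[L [K [LB /class_blockP KB -> _ K1]]].
rewrite /conj_proj trmx_mul -!mulmxA [K *m _]mulmxA -KB -mulmxA.
rewrite [K *m _]mulmxA (mulmx1C K1) mul1mx.
apply: (class_blockM LB); apply: class_blockM (class_block_tr LB).
exact: class_block_proj.
Qed.

Definition class_part C : 'M[R]_n :=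
  \matrix_(i, j) if c2 i == c2 j then C i j else 0.

(** This reads the left factor C D^T off the projections: its column y is column y of Q_y. *)
Lemma mul_class_part C x y : (C *m (class_part C)^T) x y = conj_proj C y x y.
Proof.
rewrite mxE conj_projE [RHS]big_mkcond; apply: eq_bigr => z _.
by rewrite !mxE eq_sym; case: eqP; rewrite ?mulr0.
Qed.

Lemma conj_proj_orth_product C : C^T *m C = 1%:M -> class_part C \in unitmx ->
  (forall j, class_block c1 (conj_proj C j)) -> orth_product C.
Proof.
move=> C1 PU QB; split=> //.
have PTU : (class_part C)^T \in unitmx by rewrite unitmx_tr.
exists (C *m (class_part C)^T), (invmx (class_part C)^T); split.
- by move=> x y cxy; rewrite mul_class_part QB.
- apply/class_blockV/class_block_tr => i j; rewrite mxE; case: eqP => //.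
- by rewrite mulmxK.
Qed.

(* The off-diagonal parts N_j of Q_j = conj_proj C j satisfy the linearisations
   at the coordinate projections of Q_j Q_k = 0 and Q_j ^ 2 = Q_j up to an error
   of at most n e max |N|; solving these linear relations gives
   max |N| <= n e max |N|. *)
Lemma conj_proj_rigid C (e : R) : C^T *m C = 1%:M -> n%:R * e < 1 ->
  (forall j x y, `|conj_proj C j x y - class_proj c2 (c2 j) x y| <= e) ->
  (forall x y : 'I_n, (y < x)%N -> c1 x != c1 y -> c2 x != c2 y ->
     conj_proj C y x y = 0) ->
  forall j, class_block c1 (conj_proj C j).
Proof.
move=> C1 ne1 Qe Q0 j0 x0 y0 c0.
have e0 : 0 <= e := le_trans (normr_ge0 _) (Qe j0 x0 y0).
pose N j : 'M[R]_n :=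
  \matrix_(x, y) if c1 x == c1 y then 0 else conj_proj C j x y.
have NE j x y : c1 x != c1 y -> N j x y = conj_proj C j x y.
  by rewrite mxE => /negPf ->.
have congrQ j k : c2 j = c2 k -> conj_proj C j = conj_proj C k.
  by rewrite /conj_proj => ->.
pose a (q : 'I_n * 'I_n * 'I_n) := `|N q.1.1 q.1.2 q.2|.
(* The bound is attained at some [q], so estimating that single entry suffices. *)
have [q tP] : exists q, forall j x y, `|N j x y| <= a q.
  pose q := [arg max_(q > (j0, x0, y0)) a q]%O; exists q => j x y.
  by rewrite /q; case: arg_maxP => //= q' _ /(_ (j, x, y)); apply.
set t := a q in tP.
(* Each summand z contributes at most e t: if z lies in the c1-class of x, it is (Q_j - E_j)_xz
   (N_k)_zy; otherwise it is (N_j)_xz (Q_k - E_k)_zy. *)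
have prodB j k x y : c1 x != c1 y ->
    `|(conj_proj C j *m conj_proj C k) x y -
      ((c2 x == c2 j)%:R * N k x y + N j x y * (c2 y == c2 k)%:R)| <=
    n%:R * e * t.
  move=> cxy; rewrite -mul_class_proj -mulmx_class_proj 3!mxE -big_split -sumrB.
  apply: le_trans (ler_norm_sum _ _ _) _.
  rewrite -mulrA mulr_natl -[n in leRHS]card_ord -sumr_const.
  apply: ler_sum => z _ /=.
  have [cxz|cxz] := eqVneq (c1 x) (c1 z).
    rewrite [N j x z]mxE cxz eqxx mul0r addr0 NE -?cxz //.
    by rewrite -mulrBl normrM ler_pM // -?NE -?cxz.
  rewrite [X in _ - (X * _ + _)]mxE.
  have [xz|_] := eqVneq x z; first by rewrite xz eqxx in cxz.
  by rewrite mul0r add0r NE // -mulrBr normrM mulrC ler_pM // -NE.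
have net0 : 0 <= n%:R * e * t.
  by apply: mulr_ge0; [exact: mulr_ge0|exact: normr_ge0].
have tle : t <= n%:R * e * t.
  rewrite {1}/t /a; case: q.1 => j x; move: q.2 => y /=.
  have [cxy|cxy] := eqVneq (c1 x) (c1 y).
    by rewrite mxE cxy eqxx normr0.
  (* If x and y are both in the class of j, or both outside it, Q_j ^ 2 = Q_j bounds the entry
     directly. If only one is, Q_j Q_y = 0 or Q_x Q_j = 0 bounds the sum of two entries, one of
     which vanishes by [Q0], up to symmetry of the projections. *)
  have [xj|xj] := eqVneq (c2 x) (c2 j); have [yj|yj] := eqVneq (c2 y) (c2 j).
  - have := prodB j j _ _ cxy; rewrite conj_projM // xj yj eqxx -NE //.
    by rewrite mul1r mulr1 opprD addNKr normrN.
  - have := prodB j y _ _ cxy.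
    rewrite conj_projM // xj !eqxx [c2 j == _]eq_sym (negPf yj).
    rewrite mul1r mulr1 mxE sub0r normrN.
    have [yx|xy|/val_inj xy] := ltngtP y x.
    + by rewrite [N y x y]NE // Q0 ?add0r // xj eq_sym.
    + rewrite [N j x y]NE // (congrQ j x) // conj_proj_sym.
      by rewrite Q0 ?normr0 // ?xj // eq_sym.
    + by rewrite xy eqxx in cxy.
  - have := prodB x j _ _ cxy; rewrite conj_projM // yj !eqxx (negPf xj).
    rewrite mul1r mulr1 mxE sub0r normrN.
    have [yx|xy|/val_inj xy] := ltngtP y x.
    + by rewrite [N j x y]NE // (congrQ j y) // Q0 ?normr0 // yj.
    + by rewrite [N x x y]NE // conj_proj_sym Q0 ?addr0 // ?yj // eq_sym.
    + by rewrite xy eqxx in cxy.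
  - have := prodB j j _ _ cxy; rewrite conj_projM // eqxx (negPf xj) (negPf yj).
    by rewrite mul0r mulr0 addr0 subr0 NE.
have t0 : t <= 0.
  rewrite leNgt; apply/negP => t_gt0.
  by move: tle; rewrite leNgt gtr_pMl // ne1.
by apply/eqP; rewrite -normr_le0 -NE // (le_trans _ t0).
Qed.

End OrthogonalProducts.

(** * The explicit chart at the identity *)

Section OrthogonalProductChart.
Context {R : realType} {T1 T2 : eqType} {n : nat}.
Variables (c1 : 'I_n -> T1) (c2 : 'I_n -> T2).
Local Notation V := 'M[R]_n.

(** One pair per equation, so its cardinality is the codimension. The second disjunct matters only
    below the diagonal, where it selects the equations on the Q_y. *)
Definition chart_pairs : pred ('I_n * 'I_n) := [pred p : 'I_n * 'I_n |
  (p.1 <= p.2)%N || (c1 p.1 != c1 p.2) && (c2 p.1 != c2 p.2)].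

(* Only the entries indexed by [chart_pairs] are used as equations. *)
Definition chart_mx (C : V) : V := \matrix_(x, y)
  if (x <= y)%N then (C^T *m C - 1%:M) x y else conj_proj c2 C y x y.

Definition pairs_row (M : V) : 'rV[R]_#|chart_pairs| :=
  \row_i M (enum_val i).1 (enum_val i).2.

Lemma pairs_row0P (M : V) :
  pairs_row M = 0 <-> forall x y, chart_pairs (x, y) -> M x y = 0.
Proof.
split=> [M0 x y xy|M0]; last first.
  apply/matrixP => i j; rewrite !mxE M0 //.
  by have := enum_valP j; case: (enum_val j).
have /matrixP/(_ 0 (enum_rank_in (xy : (x, y) \in chart_pairs) (x, y))) := M0.
by rewrite !mxE enum_rankK_in.
Qed.

(** The differential of [chart_mx] at 1: v + v^T on and above the diagonal, and below it the (x, y)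
    entry of v E_y + E_y v^T. *)
Definition chart_linear (v : V) : V := \matrix_(x, y)
  if (x <= y)%N then v x y + v y x
  else v x y + (c2 x == c2 y)%:R * v y x.

(** The equations have degree two, so their expansion at 1 is exact, with quadratic part [Q v]. *)
Lemma is_derive_chart v :
  is_derive (1%:M : V) v (fun C => pairs_row (chart_mx C))
    (pairs_row (chart_linear v)).
Proof.
pose Q v : V := \matrix_(x, y)
  if (x <= y)%N then (v^T *m v) x y else conj_proj c2 v y x y.
apply: (is_derive_quadratic (c := pairs_row (Q v))) => h.
suff -> : chart_mx (h *: v + 1%:M) =
    chart_mx 1%:M + h *: chart_linear v + h ^+ 2 *: Q v.
  by apply/matrixP => i0 i; rewrite !mxE.
have tE : (h *: v + 1%:M)^T = h *: v^T + 1%:M by rewrite linearD linearZ /= trmx1.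
have e1 : (h *: v + 1%:M)^T *m (h *: v + 1%:M) - 1%:M =
    h *: (v + v^T) + h ^+ 2 *: (v^T *m v).
  rewrite tE mulmxDl !mulmxDr mul1mx !mulmx1 -scalemxAl -scalemxAr.
  by move: (v^T *m v) => P; apply/matrixP => x y; rewrite !mxE; ring.
have e2 y : conj_proj c2 (h *: v + 1%:M) y = class_proj c2 (c2 y) +
    h *: (v *m class_proj c2 (c2 y) + class_proj c2 (c2 y) *m v^T) +
    h ^+ 2 *: conj_proj c2 v y.
  rewrite /conj_proj tE !mulmxDl !mulmxDr !mul1mx !mulmx1.
  rewrite -!scalemxAl -!scalemxAr.
  move: (v *m _ *m _) => P; move: (v *m _) (_ *m v^T) => Q1 Q2.
  by apply/matrixP => x z; rewrite !mxE; ring.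
apply/matrixP => x y.
transitivity (chart_mx 1%:M x y + h * chart_linear v x y + h ^+ 2 * Q v x y);
  last by rewrite !mxE.
rewrite [LHS]mxE [chart_mx _ x y]mxE [chart_linear _ x y]mxE [Q v x y]mxE e1 e2.
rewrite trmx1 mulmx1 subrr /conj_proj trmx1 mulmx1 mul1mx.
case: leqP => _.
  by move: (_ *m _) => M; rewrite !mxE; ring.
have addE (A B : V) : (A + B) x y = A x y + B x y by rewrite mxE.
have scaleE a (A : V) : (a *: A) x y = a * A x y by rewrite mxE.
rewrite !addE !scaleE !addE mulmx_class_proj mul_class_proj eqxx mulr1.
by rewrite [v^T x y]mxE.
Qed.

(** On [chart_pairs] the system is triangular: an equation below the diagonal reads v_xy = w_xy
    since x and y differ in c2-class, and one above it is then solved for v_xy. *)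
Lemma chart_linear_surj (w : 'rV[R]_#|chart_pairs|) :
  exists v, pairs_row (chart_linear v) = w.
Proof.
(* W extends w by zero to all index pairs. *)
pose W p := \sum_i w 0 i * (enum_val i == p)%:R.
pose v : V := \matrix_(x, y)
  if x == y then W (x, y) / 2 else
  W (x, y) - if (x < y)%N then W (y, x) else 0.
exists v; apply/matrixP => i0 i; rewrite (ord1 i0) mxE.
have -> : w 0 i = W (enum_val i).
  rewrite /W (bigD1 i) //= eqxx mulr1 big1 ?addr0 // => j /negPf ji.
  by rewrite (inj_eq enum_val_inj) ji mulr0.
have : chart_pairs (enum_val i) by exact: (enum_valP i).
case: (enum_val i) => x y; rewrite /chart_pairs mxE /= => xy.
case: ltngtP xy => /= [xy _|yx /andP[_ /negPf cxy]|/val_inj -> _].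
- rewrite !mxE xy [y == x]eq_sym ltnNge ltnW //=.
  have [e|_] := eqVneq x y; first by rewrite e ltnn in xy.
  by rewrite subr0 subrK.
- rewrite cxy mul0r addr0 mxE ltnNge ltnW // subr0.
  by have [e|_] := eqVneq x y; first by rewrite e ltnn in yx.
- by rewrite mxE eqxx -splitr.
Qed.

Lemma polyfun_trmx x y : polyfun (fun C : V => C^T x y).
Proof. by under eq_fun do rewrite mxE; exact: polyfun_coord. Qed.

Lemma polyfun_conj_proj j x y : polyfun (fun C : V => conj_proj c2 C j x y).
Proof.
apply: polyfun_mulmx; last exact: polyfun_trmx.
by apply: polyfun_mulmx => ? ?; [exact: polyfun_coord|exact: polyfun_cst].
Qed.

Lemma polyfun_chart i j : polyfun (fun C : V => pairs_row (chart_mx C) i j).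
Proof.
under eq_fun do rewrite mxE mxE.
case: leqP => _; last exact: polyfun_conj_proj.
under eq_fun do rewrite mxE.
apply: polyfunD; last exact: polyfun_cst.
by apply: polyfun_mulmx => ? ?; [exact: polyfun_trmx|exact: polyfun_coord].
Qed.

Lemma orth_product_chart : poly_chart (orth_product c1 c2) (1%:M : V).
Proof.
exists _, (fun C => pairs_row (chart_mx C)); split.
- exact: polyfun_chart.
- have dP : polyfun (fun C : V => \det (class_part c2 C)).
    apply: polyfun_det => k l; under eq_fun do rewrite mxE.
    by case: (_ == _); [exact: polyfun_coord|exact: polyfun_cst].
  (* This choice gives n e < 1, as [conj_proj_rigid] requires. *)
  pose e : R := n.+1%:R^-1.
  have e0 : 0 < e by rewrite invr_gt0 ltr0n.
  have near_q : \forall C \near (1%:M : V), forall j x y,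
      `|conj_proj c2 C j x y - class_proj c2 (c2 j) x y| <= e.
    apply: (filter_forall (nbhs_filter (1%:M : V))) => j.
    apply: (filter_forall (nbhs_filter (1%:M : V))) => x.
    apply: (filter_forall (nbhs_filter (1%:M : V))) => y.
    have qc : continuous (fun C : V => conj_proj c2 C j x y).
      exact/polyfun_continuous/polyfun_conj_proj.
    have q1 : conj_proj c2 (1%:M : V) j = class_proj c2 (c2 j).
      by rewrite /conj_proj trmx1 mulmx1 mul1mx.
    have /(cvgrPdist_le (FF := nbhs_filter (1%:M : V)))/(_ e e0) := qc 1%:M.
    by apply: filterS => C; rewrite q1 distrC.
  have near_d : \forall C \near (1%:M : V), class_part c2 C \in unitmx.
    have dc : continuous (fun C : V => \det (class_part c2 C)).
      exact: polyfun_continuous.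
    have : \forall C \near (1%:M : V), \det (class_part c2 C) != 0.
      apply: (dc 1%:M [set x | x != 0]).
      apply: open_nbhs_nbhs; split; first exact: open_neq.
      have -> : class_part c2 1%:M = 1%:M :> V.
        apply/matrixP => x y; rewrite !mxE.
        by have [->|_] := eqVneq x y; rewrite ?eqxx ?if_same.
      by rewrite /= det1 oner_neq0.
    by apply: filterS => C; rewrite unitmxE unitfE.
  near=> C; rewrite pairs_row0P; split=> [CS x y|C0].
    rewrite /chart_pairs /= => xy; rewrite mxE; have [_|yx] := leqP x y.
      by case: CS => -> _; rewrite subrr mxE.
    move: xy; rewrite leqNgt yx => /andP[c1xy _].
    exact: (orth_product_conj_proj y CS).
  (* The entries with x <= y suffice because C^T C is symmetric. *)
  have CC (x y : 'I_n) : (x <= y)%N -> (C^T *m C) x y = (1%:M : V) x y.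
    move=> xy; have := C0 x y; rewrite /chart_pairs /= xy => /(_ isT).
    by rewrite mxE xy mxE [X in _ + X]mxE => /eqP; rewrite subr_eq0 => /eqP.
  have C1 : C^T *m C = 1%:M.
    apply/matrixP => x y; have [/CC //|/ltnW/CC yx] := leqP x y.
    have CT : (C^T *m C)^T = C^T *m C by rewrite trmx_mul trmxK.
    by rewrite -CT mxE yx !mxE eq_sym.
  apply: conj_proj_orth_product => //; first by near: C.
  apply: (conj_proj_rigid (e := e)) => //.
  + by rewrite /e ltr_pdivrMr ?ltr0n // mul1r ltr_nat.
  + by near: C.
  + move=> x y yx c1xy c2xy; have := C0 x y.
    by rewrite /chart_pairs /= leqNgt yx c1xy c2xy mxE leqNgt yx => /(_ isT).
- move=> w; have [v <-] := chart_linear_surj w; exists v.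
  by case: (is_derive_chart v).
Unshelve. all: by end_near. Qed.

End OrthogonalProductChart.

(** * Translation from the identity back to [GS] *)

Lemma orthogonal_mxM (R : realType) n (A B : 'M[R]_n) :
  orthogonal_mx A -> orthogonal_mx B -> orthogonal_mx (A *m B).
Proof.
by move=> A1 B1; rewrite /orthogonal_mx /= trmx_mul -mulmxA [A^T *m _]mulmxA A1 mul1mx.
Qed.

Lemma orthogonal_mx_tr (R : realType) n (A : 'M[R]_n) :
  orthogonal_mx A -> orthogonal_mx A^T.
Proof. by move=> A1; rewrite /orthogonal_mx /= trmxK; exact: mulmx1C. Qed.

Lemma orthogonal_mx_perm (R : realType) n (s : 'S_n) :
  orthogonal_mx (perm_mx s : 'M[R]_n).
Proof.
by rewrite /orthogonal_mx /= tr_perm_mx -perm_mxM mulVg perm_mx1.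
Qed.

Theorem theorem3 (R : realType) (n b : nat) (PL P PR : 'S_n) :
  (0 < n)%N -> (0 < b)%N -> (b %| n)%N ->
  @GS R n b PL P PR `<=` @orthogonal_mx R n /\
  embedded_submanifold (@GS R n b PL P PR).
Proof.
move=> _ _ _; split; first by move=> A [].
have permO (s : 'S_n) := @orthogonal_mx_perm R n s.
have permTO (s : 'S_n) := orthogonal_mx_tr (permO s).
have permVK (s : 'S_n) : (perm_mx s)^T *m perm_mx s = 1%:M :> 'M[R]_n := permO s.
have permK (s : 'S_n) : perm_mx s *m (perm_mx s)^T = 1%:M :> 'M[R]_n.
  exact: mulmx1C.
(* Moving P to the right of the second factor conjugates that factor by P, which relabels its blocks
   by c2. *)
pose c1 (i : 'I_n) := (i %/ b)%N; pose c2 (i : 'I_n) := (P i %/ b)%N.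
have conjP (M : 'M[R]_n) : block_diag_b b M ->
    class_block c2 (perm_mx P *m M *m (perm_mx P)^T).
  move=> MB i j cij; rewrite tr_perm_mx -col_permE -row_permE !mxE.
  by apply: MB; rewrite ?invgK.
have conjPV (M : 'M[R]_n) : class_block c2 M ->
    block_diag_b b ((perm_mx P)^T *m M *m perm_mx P).
  move=> MB i j cij.
  rewrite tr_perm_mx -row_permE -{2}[P]invgK -col_permE !mxE.
  by apply: MB; rewrite /c2 !permKV.
apply: poly_chart_embedded => A0 [A01 [L0 [R0 [L0B R0B A0E]]]].
pose C0 := (perm_mx PL)^T *m A0 *m (perm_mx PR)^T *m (perm_mx P)^T.
have C0E : C0 = L0 *m (perm_mx P *m R0 *m (perm_mx P)^T).
  rewrite /C0 A0E -!mulmxA [perm_mx PR *m _]mulmxA permK mul1mx.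
  by rewrite [(perm_mx PL)^T *m _]mulmxA permVK mul1mx !mulmxA.
have C0S : orth_product c1 c2 C0.
  split; last by exists L0, (perm_mx P *m R0 *m (perm_mx P)^T); split=> //; exact: conjP.
  by do !apply: orthogonal_mxM.
have [L [K [LB KB C0LK L1 K1]]] := orth_product_factors C0S.
(* Besides undoing the permutations, U and W multiply by L^T and K^T, taken from the orthogonal
   factors of C0: this sends A0 to L^T C0 K^T = 1 and keeps each factor in its block algebra. *)
pose U := L^T *m (perm_mx PL)^T; pose W := (perm_mx PR)^T *m (perm_mx P)^T *m K^T.
pose U' := perm_mx PL *m L; pose W' := K *m perm_mx P *m perm_mx PR.
have UO : orthogonal_mx U by apply: orthogonal_mxM => //; exact: orthogonal_mx_tr.
have WO : orthogonal_mx W.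
  by do !apply: orthogonal_mxM => //; exact: orthogonal_mx_tr.
have U'O : orthogonal_mx U' by exact: orthogonal_mxM.
have W'O : orthogonal_mx W' by do !apply: orthogonal_mxM.
have UU : U *m U' = 1%:M.
  by rewrite /U /U' -mulmxA [(perm_mx PL)^T *m _]mulmxA permVK mul1mx.
have WW : W' *m W = 1%:M.
  rewrite /W /W' -!mulmxA [perm_mx PR *m _]mulmxA permK mul1mx.
  by rewrite [perm_mx P *m _]mulmxA permK mul1mx (mulmx1C K1).
have GSE : GS b PL P PR = [set A : 'M[R]_n | orth_product c1 c2 (U *m A *m W)].
  apply/seteqP; split=> A /= [A1 [L' [K' [LB' KB' AE]]]].
    split; first exact: orthogonal_mxM (orthogonal_mxM UO A1) WO.
    exists (L^T *m L'), (perm_mx P *m K' *m (perm_mx P)^T *m K^T); split.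
    + exact: class_blockM (class_block_tr LB) LB'.
    + exact: class_blockM (conjP _ KB') (class_block_tr KB).
    + rewrite AE /U /W -!mulmxA [perm_mx PR *m _]mulmxA permK mul1mx.
      by rewrite [(perm_mx PL)^T *m _]mulmxA permVK mul1mx.
  have AUW : A = U' *m (U *m A *m W) *m W'.
    rewrite -[LHS]mul1mx -(mulmx1C UU) -[LHS]mulmx1 -(mulmx1C WW).
    by rewrite !mulmxA.
  split; first by rewrite AUW; exact: orthogonal_mxM (orthogonal_mxM U'O A1) W'O.
  exists (L *m L'), ((perm_mx P)^T *m (K' *m K) *m perm_mx P); split.
  - exact: class_blockM LB LB'.
  - exact/conjPV/class_blockM.
  - by rewrite AUW AE /U' /W' -!mulmxA [perm_mx P *m (_^T *m _)]mulmxA permK mul1mx.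
rewrite GSE; apply: poly_chart_mulmx UU WW _.
have -> : U *m A0 *m W = 1%:M; last exact: orth_product_chart.
rewrite /U /W -(mulmxA L^T) !mulmxA.
rewrite -(mulmxA L^T) -(mulmxA L^T) -(mulmxA L^T) -/C0 C0LK.
by rewrite mulmxA L1 mul1mx (mulmx1C K1).
Qed.
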